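(* In the restricted cut-and-choose setting described in the context (Protocol 1), assume the expected number of test rounds satisfies $N\ge 1$. Let $\varepsilon_H,\varepsilon_D\ge 0$ be such that, for the client input $\psi=|+\rangle\langle+|^{\otimes k}$ and unitary $U=\mathbb{1}_{\mathcal{X}}$, $$F(\rho_H,|+\rangle\langle+|^{\otimes k})\ge 1-\varepsilon_H$$ and, for every $\alpha\in\mathbb{R}$ (with the attack placement fixed as either before or after the delegated unitary), $$\max_{p\in[0,1]}F\big(\rho_D^\alpha,\;p|+\rangle\langle+|^{\otimes k}+(1-p)|\bot\rangle\langle\bot|\big)\ge 1-\varepsilon_D .$$ (These hold in particular whenever the protocol is $\varepsilon_H$-correct and $\varepsilon_D$-secure in the sense of the fidelity-based definition in the context, since the phase attacks are admissible server attacks.) Then $\varepsilon_H+\varepsilon_D\ge \frac{1}{7N}$.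
   Context: Restricted cut-and-choose setting. Fix $k\ge 1$, $\mathcal{X}=\mathbb{C}^{2^k}$, $P(\alpha)=\mathrm{diag}(1,e^{i\alpha})$, $A_\alpha=\mathbb{1}_2^{\otimes(k-1)}\otimes P(\alpha)$, $|+\rangle=(|0\rangle+|1\rangle)/\sqrt2$, $|+_\alpha\rangle=(|0\rangle+e^{i\alpha}|1\rangle)/\sqrt2$. Let $\Omega$ be a probability distribution on $\mathbb{N}=\{0,1,\dots\}$ (number $n$ of test rounds) with finite mean $N=\sum_n n\Omega(n)$. For each $n$ and $i\in\{1,\dots,n+1\}$ there are a test unitary $T_{n,i}\in\mathrm{U}(\mathcal{X})$ and a test input unit vector $|\chi_{n,i}\rangle\in\mathcal{X}$, and for each $n$ an operator $0\le\mu_{k,n}\le\mathbb{1}$ on $\mathcal{X}^{\otimes n}$ (accept outcome). The output round $\ell$ is uniform on $\{1,\dots,n+1\}$, rounds $i\neq\ell$ are test rounds; after all rounds the client measures the $n$ test outputs with $\{\mu_{k,n},\mathbb{1}-\mu_{k,n}\}$, outputs the computation-round output on acceptance and $|\bot\rangle$ otherwise, where $|\bot\rangle$ is a unit vector orthogonal to $\mathcal{X}$ (states live on $\mathcal{X}\oplus\mathbb{C}|\bot\rangle$). The phase attack with parameter $\alpha$ replaces every delegated unitary $T$ by $T^\alpha=TA_\alpha$ (for all rounds) or by $T^\alpha=A_\alpha T$ (for all rounds). Define $p^H_{n,\ell}=\mathrm{Tr}[\mu_{k,n}\bigotimes_{i\ne\ell}T_{n,i}|\chi_{n,i}\rangle\langle\chi_{n,i}|T_{n,i}^\dagger]$,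 $p^D_{n,\ell}$ the same with $T_{n,i}$ replaced by $T^\alpha_{n,i}$, $p_H=\sum_n\frac{\Omega(n)}{n+1}\sum_{\ell=1}^{n+1}p^H_{n,\ell}$, $p^\alpha_D=\sum_n\frac{\Omega(n)}{n+1}\sum_{\ell=1}^{n+1}p^D_{n,\ell}$. For input $|+\rangle\langle+|^{\otimes k}$ and $U=\mathbb{1}$, the client's output states are $\rho_H=p_H|+\rangle\langle+|^{\otimes k}+(1-p_H)|\bot\rangle\langle\bot|$ (honest server) and $\rho^\alpha_D=p^\alpha_D|+\rangle\langle+|^{\otimes (k-1)}\otimes|+_\alpha\rangle\langle+_\alpha|+(1-p^\alpha_D)|\bot\rangle\langle\bot|$ (phase attack). Fidelity: $F(\rho,\sigma)=\big(\mathrm{Tr}\sqrt{\sqrt\rho\,\sigma\sqrt\rho}\big)^2$. Fidelity-based definition: a protocol is $\varepsilon_H$-correct and $\varepsilon_D$-secure if for every input $\psi$ and unitary $U$, the honest output $\rho_H$ satisfies $F(\rho_H,U\psi U^\dagger)\ge1-\varepsilon_H$, and for every server attack the output $\rho_D$ satisfies $\max_{p\in[0,1]}F(\rho_D,pU\psi U^\dagger+(1-p)|\bot\rangle\langle\bot|)\ge1-\varepsilon_D$. *)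

(* Defs.v *)
From HB Require Import structures.
From mathcomp Require Import all_boot all_order all_algebra.
From mathcomp Require Import sesquilinear spectral.
From mathcomp Require Import complex.
From mathcomp Require Import boolp classical_sets reals topology normedtype sequences trigo.
From Stdlib Require Import ClassicalEpsilon.

Set Implicit Arguments.
Unset Strict Implicit.
Unset Printing Implicit Defensive.

Import Order.TTheory GRing.Theory Num.Theory.
Import numFieldNormedType.Exports.
Local Open Scope ring_scope.
Local Open Scope sesquilinear_scope.
Local Open Scope complex_scope.

Section Defs.
Context {R : realType}.
Local Notation C := (complex R).

(* positive semidefinite: <v, A v> >= 0 for all v (in the partial order of C;
   this forces <v,Av> to be real, hence A Hermitian). *)
Definition psd n (A : 'M[C]_n) : Prop :=
  forall v : 'cV[C]_n, 0 <= (v^t* *m A *m v) 0 0.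

Definition msqrt n (A : 'M[C]_n) : 'M[C]_n :=
  epsilon (inhabits 0) (fun B => psd B /\ B *m B = A).

Definition fidelity n (rho sigma : 'M[C]_n) : C :=
  (\tr (msqrt (msqrt rho *m sigma *m msqrt rho))) ^+ 2.

Definition proj n (v : 'cV[C]_n) : 'M[C]_n := v *m v^t*.

Definition expi (a : R) : C := (cos a +i* sin a)%C.

(* Qubit ordering convention: basis vector |b_1 ... b_k> of (C^2)^{(x)k}
   has index b_1 2^(k-1) + ... + b_k, so the last qubit is the parity bit. *)

(* A_alpha = 1^{(x)(k-1)} (x) P(alpha), P(alpha) = diag(1, e^{i alpha}) *)
Definition Aphase k (a : R) : 'M[C]_(2 ^ k) :=
  diag_mx (\row_(i < 2 ^ k) (if odd i then expi a else 1)).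

Definition plusk k : 'cV[C]_(2 ^ k) :=
  \col_(i < 2 ^ k) (Num.sqrt (2 ^+ k : R))^-1%:C.

(* |+>^{(x)(k-1)} (x) |+_alpha> *)
Definition plusk_alpha k (a : R) : 'cV[C]_(2 ^ k) :=
  \col_(i < 2 ^ k) ((Num.sqrt (2 ^+ k : R))^-1%:C * (if odd i then expi a else 1)).

(* The output space X (+) C|bot>, indexed by 'I_(1 + 2^k):
   index 0 is |bot>, the remaining 2^k indices are X. *)
Definition embX k (v : 'cV[C]_(2 ^ k)) : 'cV[C]_(1 + 2 ^ k) := col_mx 0 v.
Definition bot k : 'cV[C]_(1 + 2 ^ k) := col_mx 1 0.

(* digit j (in base 2^k) of a natural number i: coordinate of tensor factor j
   when X^{(x)n} = C^((2^k)^n) (factor j <-> digit of weight (2^k)^j) *)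
Lemma digit_lt k (i j : nat) : ((i %/ (2 ^ k) ^ j) %% 2 ^ k < 2 ^ k)%N.
Proof. by rewrite ltn_pmod // expn_gt0. Qed.
Definition digit k (j i : nat) : 'I_(2 ^ k) := Ordinal (digit_lt k i j).

Definition tensvec k n (v : 'I_n -> 'cV[C]_(2 ^ k)) : 'cV[C]_((2 ^ k) ^ n) :=
  \col_(i < (2 ^ k) ^ n) \prod_(j < n) v j (digit k j i) 0.

(* Protocol data:
   T n i, chi n i for rounds i : 'I_n.+1 (0-indexed rounds 0..n),
   mu n the accept operator on X^{(x)n}.  For output round l : 'I_n.+1,
   the test rounds in increasing order are lift l j, j : 'I_n. *)

Definition pacc k n (U : 'I_n.+1 -> 'M[C]_(2 ^ k))
  (chi : 'I_n.+1 -> 'cV[C]_(2 ^ k)) (mu : 'M[C]_((2 ^ k) ^ n)) (l : 'I_n.+1) : R :=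
  complex.Re (\tr (mu *m proj (tensvec (fun j : 'I_n => U (lift l j) *m chi (lift l j))))).

Definition pavg (Omega : nat -> R) (p : forall n, 'I_n.+1 -> R) : R :=
  limn (series (fun n => Omega n / n.+1%:R * \sum_(l < n.+1) p n l)).

Definition attack k (before : bool) (a : R) (T : 'M[C]_(2 ^ k)) : 'M[C]_(2 ^ k) :=
  if before then T *m Aphase k a else Aphase k a *m T.

Definition pH k (Omega : nat -> R) (T : forall n, 'I_n.+1 -> 'M[C]_(2 ^ k))
  (chi : forall n, 'I_n.+1 -> 'cV[C]_(2 ^ k)) (mu : forall n, 'M[C]_((2 ^ k) ^ n)) : R :=
  pavg Omega (fun n l => pacc (T n) (chi n) (mu n) l).

Definition pD k (Omega : nat -> R) (T : forall n, 'I_n.+1 -> 'M[C]_(2 ^ k))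
  (chi : forall n, 'I_n.+1 -> 'cV[C]_(2 ^ k)) (mu : forall n, 'M[C]_((2 ^ k) ^ n))
  (before : bool) (a : R) : R :=
  pavg Omega (fun n l => pacc (fun i => attack before a (T n i)) (chi n) (mu n) l).

Definition rhoH k (p : R) : 'M[C]_(1 + 2 ^ k) :=
  p%:C *: proj (embX (plusk k)) + (1 - p)%:C *: proj (bot k).

Definition rhoD k (p a : R) : 'M[C]_(1 + 2 ^ k) :=
  p%:C *: proj (embX (plusk_alpha k a)) + (1 - p)%:C *: proj (bot k).

End Defs.

(* Main.v *)
Require Import Defs.
From HB Require Import structures.
From mathcomp Require Import all_boot all_order all_algebra.
From mathcomp Require Import sesquilinear spectral.
From mathcomp Require Import complex.
From mathcomp Require Import boolp classical_sets reals topology normedtype sequences trigo.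
From mathcomp Require Import ring lra.
From Stdlib Require Import ClassicalEpsilon.

(** The honest fidelity is the honest acceptance probability [h], and the best fidelity
    of the attacked output with an ideal state is [1 - d * s], where [d] is the acceptance
    probability under attack and [s = sin^2 (alpha / 2)]; hence [h >= 1 - epsH] and
    [d * s <= epsD].  In each test round the honest and the attacked states have squared
    overlap at least [1 - s], so over [n] rounds at least [(1 - s)^n >= 1 - n s], and the
    Cauchy-Schwarz inequality for the forms of [mu] and [1 - mu] bounds the change of the
    acceptance probability by [sqrt (n s)].  Averaging, [h - d <= sqrt (N s)].  The choice
    [s = 4 / (9 N)], which maximises [x^2 (1 - x)] for [x = sqrt (N s)], gives
    [epsH + epsD >= 4 / (27 N)]. *)

Set Implicit Arguments.
Unset Strict Implicit.
Unset Printing Implicit Defensive.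

Import Order.TTheory GRing.Theory Num.Theory.
Import numFieldNormedType.Exports.
Local Open Scope ring_scope.
Local Open Scope sesquilinear_scope.

(** * Positive semidefinite forms, Cauchy-Schwarz and uniqueness of positive square roots *)

Section Forms.
Context {C : numClosedFieldType}.

Lemma adjmxD m n (A B : 'M[C]_(m, n)) : (A + B)^t* = A^t* + B^t*.
Proof. by rewrite raddfD /= map_mxD. Qed.

Lemma adjmxB m n (A B : 'M[C]_(m, n)) : (A - B)^t* = A^t* - B^t*.
Proof. by rewrite raddfB /= map_mxB. Qed.

Lemma adjmxZ m n (z : C) (A : 'M[C]_(m, n)) : (z *: A)^t* = z^* *: A^t*.
Proof. by rewrite linearZ /= map_mxZ. Qed.

Lemma adjmxM m n p (A : 'M[C]_(m, n)) (B : 'M[C]_(n, p)) :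
  (A *m B)^t* = B^t* *m A^t*.
Proof. by rewrite trmx_mul map_mxM. Qed.

Definition sform n (A : 'M[C]_n) (v w : 'cV[C]_n) : C := (v^t* *m A *m w) 0 0.

(** Convertible with [psd], but stated over any [numClosedFieldType]. *)
Definition semipos n (A : 'M[C]_n) : Prop := forall v, 0 <= sform A v v.

Lemma sformDl n (A : 'M[C]_n) u v w : sform A (u + v) w = sform A u w + sform A v w.
Proof. by rewrite /sform adjmxD !mulmxDl mxE. Qed.

Lemma sformDr n (A : 'M[C]_n) u v w : sform A w (u + v) = sform A w u + sform A w v.
Proof. by rewrite /sform mulmxDr mxE. Qed.

Lemma sformZl n (A : 'M[C]_n) z v w : sform A (z *: v) w = z^* * sform A v w.
Proof. by rewrite /sform adjmxZ -!scalemxAl mxE. Qed.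

Lemma sformZr n (A : 'M[C]_n) z v w : sform A v (z *: w) = z * sform A v w.
Proof. by rewrite /sform -scalemxAr mxE. Qed.

Lemma sform_addmx n (A B : 'M[C]_n) v w : sform (A + B) v w = sform A v w + sform B v w.
Proof. by rewrite /sform mulmxDr mulmxDl mxE. Qed.

Lemma sform_scalemx n z (A : 'M[C]_n) v w : sform (z *: A) v w = z * sform A v w.
Proof. by rewrite /sform -scalemxAr -scalemxAl mxE. Qed.

Lemma sform1 n (v w : 'cV[C]_n) : sform 1%:M v w = (v^t* *m w) 0 0.
Proof. by rewrite /sform mulmx1. Qed.

(** Polarisation: the form is real at [v + w] and at [v + i w], which determines the sum and the
    difference of the two mixed terms. *)
Lemma semipos_sform_conj n (A : 'M[C]_n) v w :
  semipos A -> sform A w v = (sform A v w)^*.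
Proof.
move=> pA.
have re u : (sform A u u)^* = sform A u u by apply/CrealP/ger0_real/pA.
have := re (v + w); have := re (v + 'i *: w).
rewrite !(sformDl, sformDr, sformZl, sformZr) !rmorphD !rmorphM /= !conjCK !re !conjCi.
move: (sform A v v) (sform A w w) (sform A v w) (sform A w v) => a b x y.
have : ('i : C) * 'i = -1 by rewrite -expr2 sqrCi.
move: ('i : C) => i ii e1 e2.
have h1 : i * (y^* - x^*) = i * (x - y).
  apply/eqP; rewrite -subr_eq0; apply/eqP.
  by move/eqP: e1; rewrite -subr_eq0 => /eqP <-; ring.
have h2 : x^* + y^* = x + y.
  apply/eqP; rewrite -subr_eq0; apply/eqP.
  by move/eqP: e2; rewrite -subr_eq0 => /eqP <-; ring.
have i0 : i != 0.
  by apply/eqP => i0; move/eqP: ii; rewrite i0 mul0r eq_sym oppr_eq0 oner_eq0.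
have h3 := mulfI i0 h1.
have two : (2 : C) != 0 by rewrite pnatr_eq0.
apply: (mulfI two); transitivity ((x + y) - (x - y)); first by ring.
by rewrite -h2 -h3; ring.
Qed.

(** Nonnegativity at [v - t (conj x) w] with [t >= 0] gives a polynomial of degree at most two in
    [t], which is then evaluated at a suitable point. *)
Lemma semipos_Cauchy_Schwarz n (A : 'M[C]_n) v w : semipos A ->
  `|sform A v w| ^+ 2 <= sform A v v * sform A w w.
Proof.
move=> pA; set x := sform A v w; set a := sform A v v; set b := sform A w w.
have a0 : 0 <= a := pA v.
have b0 : 0 <= b := pA w.
set Y := `|x| ^+ 2; have Y0 : 0 <= Y by rewrite exprn_ge0.
have key t : 0 <= t -> 0 <= a - 2 * t * Y + t ^+ 2 * Y * b.
  move=> t0; have tc : t^* = t by apply/CrealP/ger0_real.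
  have := pA (v + (- (t * x^*)) *: w).
  rewrite !(sformDl, sformDr, sformZl, sformZr) (semipos_sform_conj v w pA) -/x -/a -/b.
  rewrite rmorphN rmorphM /= tc conjCK /Y normCK.
  by congr (0 <= _); ring.
have [b00|bn0] := eqVneq b 0.
  have [->|Yn0] := eqVneq Y 0; first by rewrite mulr_ge0.
  (* For [b = 0] the polynomial is affine in [t]; this [t] sends it to [- (a + 2) < 0]. *)
  have /key : 0 <= (a + 1) / Y by rewrite divr_ge0 // addr_ge0.
  have -> : a - 2 * ((a + 1) / Y) * Y + ((a + 1) / Y) ^+ 2 * Y * b = - (a + 2).
    by rewrite b00; field.
  by rewrite oppr_ge0 lt_geF // ltr_wpDl.
have bp : 0 < b by rewrite lt0r bn0.
(* For [b > 0] the polynomial is minimal at [t = 1 / b]. *)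
have /key : 0 <= b^-1 by rewrite invr_ge0.
have -> : a - 2 * b^-1 * Y + b^-1 ^+ 2 * Y * b = a - Y / b by field.
by rewrite subr_ge0 ler_pdivrMr.
Qed.

(** The diagonal of [A^t* *m A] consists of the squared norms of the columns of [A]. *)
Lemma adjmx_mul_eq0 m n (A : 'M[C]_(m, n)) : A^t* *m A = 0 -> A = 0.
Proof.
move=> /matrixP A0; apply/matrixP => i j; rewrite mxE; move: (A0 j j).
rewrite !mxE => /eqP; under eq_bigr do rewrite !mxE -normCKC.
rewrite psumr_eq0 => [|k _]; last by rewrite exprn_ge0.
by move=> /allP/(_ i); rewrite mem_index_enum => /(_ isT); rewrite sqrf_eq0 normr_eq0 => /eqP.
Qed.

(** Cauchy-Schwarz for [A *m v] and [v]: the mixed value is the squared norm of [A *m v], and the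
    bound has a zero factor. *)
Lemma semipos_ker n (A : 'M[C]_n) v : semipos A -> sform A v v = 0 -> A *m v = 0.
Proof.
move=> pA v0; apply: adjmx_mul_eq0.
have := semipos_Cauchy_Schwarz (A *m v) v pA.
rewrite v0 mulr0 => h; have := le_anti (introT andP (conj h (exprn_ge0 2 (normr_ge0 _)))).
move=> /eqP; rewrite sqrf_eq0 normr_eq0 /sform -mulmxA => /eqP h0.
by apply/matrixP => i j; rewrite !ord1 h0 mxE.
Qed.

Lemma semipos_adjmx n (A : 'M[C]_n) : semipos A -> A^t* = A.
Proof.
move=> pA; apply/matrixP => i j.
have e p q : sform A (delta_mx p 0) (delta_mx q 0) = A p q.
  by rewrite /sform trmx_delta map_delta_mx -rowE -colE !mxE.
by rewrite !mxE -!e -semipos_sform_conj.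
Qed.

(* [D = B - S] satisfies [B D + D S = 0], so [tr (D B D) + tr (D S D) = 0]; both terms are
   nonnegative, which forces [B D = S D = 0] and hence [D^2 = 0]. *)
Lemma semipos_sqrt_inj n (B S : 'M[C]_n) :
  semipos B -> semipos S -> B *m B = S *m S -> B = S.
Proof.
move=> pB pS e; set D := B - S.
have hD : D^t* = D by rewrite adjmxB !semipos_adjmx.
have dE (A : 'M[C]_n) i : (D *m A *m D) i i = sform A (col i D) (col i D).
  rewrite /sform colE adjmxM hD trmx_delta map_delta_mx.
  by rewrite -!mulmxA -rowE !mulmxA -colE !mxE.
have tr0 : \tr (D *m B *m D) + \tr (D *m S *m D) = 0.
  rewrite [X in _ + X]mxtrace_mulC -raddfD /=.
  rewrite -!mulmxA -mulmxDr.
  have -> : B *m D + D *m S = 0.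
    by rewrite mulmxBr mulmxBl e addrA subrK subrr.
  by rewrite mulmx0 raddf0.
have ker (A : 'M[C]_n) : semipos A -> \tr (D *m A *m D) = 0 -> A *m D = 0.
  move=> pA /eqP; rewrite psumr_eq0 => [/allP t0|i _]; last by rewrite dE.
  apply/matrixP => i j.
  have /(semipos_ker pA) : sform A (col j D) (col j D) = 0.
    by rewrite -dE; apply/eqP; have := t0 j; rewrite mem_index_enum => /(_ isT).
  by rewrite colE mulmxA -colE => /matrixP/(_ i 0); rewrite !mxE.
have ge0 (A : 'M[C]_n) : semipos A -> 0 <= \tr (D *m A *m D).
  by move=> pA; apply: sumr_ge0 => i _; rewrite dE.
move/eqP: tr0; rewrite paddr_eq0 ?ge0// => /andP[/eqP/ker BD /eqP/ker SD].
apply/eqP; rewrite -subr_eq0 -/D; apply/eqP/adjmx_mul_eq0.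
by rewrite hD {1}/D mulmxBl BD // SD // subrr.
Qed.

End Forms.

Local Open Scope complex_scope.

(** * Square roots and fidelity of mixtures of two orthogonal pure states *)

Section Fidelity.
Context {R : realType}.
Local Notation C := (complex R).

(** [msqrt] is an [epsilon] choice; uniqueness of the positive root identifies it with any root that
    can be exhibited. *)
Lemma msqrt_eq n (A B : 'M[C]_n) : psd B -> B *m B = A -> msqrt A = B.
Proof.
move=> pB BA; have [pS SA] : psd (msqrt A) /\ msqrt A *m msqrt A = A.
  by apply: (epsilon_spec (inhabits 0) (fun B => psd B /\ B *m B = A)); exists B.
by apply: semipos_sqrt_inj => //; rewrite SA BA.
Qed.

Lemma projM n (u v : 'cV[C]_n) (c : C) :
  u^t* *m v = c%:M -> proj u *m proj v = c *: (u *m v^t*).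
Proof.
by move=> uv; rewrite /proj mulmxA -[u *m _ *m v]mulmxA uv mul_mx_scalar scalemxAl.
Qed.

Lemma proj_idem n (u : 'cV[C]_n) : u^t* *m u = 1%:M -> proj u *m proj u = proj u.
Proof. by move=> /projM ->; rewrite scale1r. Qed.

Lemma proj_orth n (u v : 'cV[C]_n) : u^t* *m v = 0 -> proj u *m proj v = 0.
Proof. by move=> uv; rewrite (@projM _ _ _ 0) ?scale0r // uv raddf0. Qed.

Lemma adjmx_orthC n (u v : 'cV[C]_n) : u^t* *m v = 0 -> v^t* *m u = 0.
Proof. by move=> uv; rewrite -[LHS]trmxCK adjmxM trmxCK uv trmx0 map_mx0. Qed.

Lemma sform_proj n (u v : 'cV[C]_n) : sform (proj u) v v = `|(u^t* *m v) 0 0| ^+ 2.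
Proof.
rewrite /sform /proj mulmxA -[_ *m u *m _ *m v]mulmxA mxE big_ord1 normCKC.
by congr (_ * _); rewrite -{1}[v^t* *m u]trmxCK adjmxM trmxCK !mxE.
Qed.

Lemma tr_proj n (u : 'cV[C]_n) : u^t* *m u = 1%:M -> \tr (proj u) = 1.
Proof. by move=> u1; rewrite /proj mxtrace_mulC u1 mxtrace1. Qed.

Lemma psd_proj2 n (u b : 'cV[C]_n) (x y : R) : 0 <= x -> 0 <= y ->
  psd (x%:C *: proj u + y%:C *: proj b).
Proof.
move=> x0 y0 v; rewrite -/(sform _ v v) sform_addmx !sform_scalemx !sform_proj.
by rewrite addr_ge0 // mulr_ge0 ?ler0c // exprn_ge0.
Qed.

Lemma msqrt_proj2 n (u b : 'cV[C]_n) (x y : R) : 0 <= x -> 0 <= y ->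
  u^t* *m u = 1%:M -> b^t* *m b = 1%:M -> u^t* *m b = 0 ->
  msqrt (x%:C *: proj u + y%:C *: proj b) =
  (Num.sqrt x)%:C *: proj u + (Num.sqrt y)%:C *: proj b.
Proof.
move=> x0 y0 u1 b1 ub; apply: msqrt_eq; first exact/psd_proj2/sqrtr_ge0/sqrtr_ge0.
rewrite mulmxDl !mulmxDr -!scalemxAl -!scalemxAr !scalerA.
rewrite !proj_idem // !proj_orth //; last exact: adjmx_orthC.
by rewrite !scaler0 addr0 add0r -!rmorphM /= -!expr2 !sqr_sqrtr.
Qed.

(** Evaluates the product under the root in [fidelity]: since [B] is orthogonal to both [P] and [Q],
    everything stays in the span of [P] and [B]. *)
Lemma orth_sandwich (F : comNzRingType) n (P Q B : 'M[F]_n) (a b z t g : F) :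
  P *m Q *m P = g *: P -> P *m B = 0 -> B *m P = 0 -> Q *m B = 0 -> B *m Q = 0 ->
  B *m B = B ->
  (a *: P + b *: B) *m (z *: Q + t *: B) *m (a *: P + b *: B) =
  (a * a * z * g) *: P + (b * b * t) *: B.
Proof.
move=> PQP PB BP QB BQ BB.
have -> : (a *: P + b *: B) *m (z *: Q + t *: B) = (a * z) *: (P *m Q) + (b * t) *: B.
  rewrite mulmxDl !mulmxDr -!scalemxAl -!scalemxAr PB BQ BB !scaler0 addr0 add0r.
  by rewrite !scalerA.
rewrite mulmxDl !mulmxDr -!scalemxAl -!scalemxAr PQP -mulmxA QB BP BB mulmx0.
by rewrite !scaler0 addr0 add0r !scalerA; congr (_ *: _ + _ *: _); ring.
Qed.

(** The sandwiched product has weights [x z g] and [y t] on the orthogonal projections onto [u] and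
    [b], so the trace of its root is the sum of their square roots. *)
Lemma fidelity_proj2 n (u v b : 'cV[C]_n) (c : C) (g x y z t : R) :
  0 <= x -> 0 <= y -> 0 <= z -> 0 <= t -> 0 <= g ->
  u^t* *m u = 1%:M -> b^t* *m b = 1%:M -> u^t* *m b = 0 -> v^t* *m b = 0 ->
  u^t* *m v = c%:M -> `|c| ^+ 2 = g%:C ->
  fidelity (x%:C *: proj u + y%:C *: proj b) (z%:C *: proj v + t%:C *: proj b)
  = ((Num.sqrt (x * z * g) + Num.sqrt (y * t)) ^+ 2)%:C.
Proof.
move=> x0 y0 z0 t0 g0 u1 b1 ub vb uv cg; rewrite /fidelity msqrt_proj2 //.
have vu : v^t* *m u = (Num.conj c)%:M.
  by rewrite -[LHS]trmxCK adjmxM trmxCK uv tr_scalar_mx map_scalar_mx.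
have puv : proj u *m proj v *m proj u = g%:C *: proj u.
  rewrite (projM uv) -scalemxAl /proj mulmxA -[u *m _ *m u]mulmxA vu mul_mx_scalar.
  by rewrite -scalemxAl scalerA -normCK cg.
rewrite (orth_sandwich _ _ _ _ puv (proj_orth ub) (proj_orth (adjmx_orthC ub))
  (proj_orth vb) (proj_orth (adjmx_orthC vb)) (proj_idem b1)).
rewrite -!rmorphM /= -!expr2 !sqr_sqrtr // msqrt_proj2 ?mulr_ge0 //.
by rewrite raddfD /= !mxtraceZ !tr_proj // !mulr1 -rmorphD -rmorphXn.
Qed.

(** Cauchy-Schwarz in the plane eliminates [p]: it pairs [(sqrt (d g), sqrt (1 - d))] with the unit
    vector [(sqrt p, sqrt (1 - p))]. *)
Lemma fidelity_proj2_le n (u v b : 'cV[C]_n) (c : C) (g d p : R) :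
  0 <= d <= 1 -> 0 <= p <= 1 -> 0 <= g ->
  u^t* *m u = 1%:M -> b^t* *m b = 1%:M -> u^t* *m b = 0 -> v^t* *m b = 0 ->
  u^t* *m v = c%:M -> `|c| ^+ 2 = g%:C ->
  fidelity (d%:C *: proj u + (1 - d)%:C *: proj b)
           (p%:C *: proj v + (1 - p)%:C *: proj b) <= (1 - d * (1 - g))%:C.
Proof.
move=> /andP[d0 d1] /andP[p0 p1] g0 u1 b1 ub vb uv cg.
rewrite (fidelity_proj2 _ _ _ _ _ u1 b1 ub vb uv cg) ?subr_ge0 // lecR.
have -> : d * p * g = d * g * p by ring.
rewrite !sqrtrM ?mulr_ge0 ?subr_ge0 //.
have := sqr_sqrtr d0; have := sqr_sqrtr g0; have := sqr_sqrtr p0.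
have d1' : 0 <= 1 - d by rewrite subr_ge0.
have p1' : 0 <= 1 - p by rewrite subr_ge0.
have := sqr_sqrtr d1'; have := sqr_sqrtr p1'.
move: (Num.sqrt (1 - d)) (Num.sqrt (1 - p)) (Num.sqrt d) (Num.sqrt p) (Num.sqrt g).
move=> B Q D P G hQ hB hP hG hD.
(* The second factor is 1; keeping it makes the deficit a perfect square by the Lagrange
   identity. *)
have -> : 1 - d * (1 - g) = (D ^+ 2 * G ^+ 2 + B ^+ 2) * (P ^+ 2 + Q ^+ 2).
  by rewrite hQ hB hP hG hD; ring.
rewrite -subr_ge0.
have -> : (D ^+ 2 * G ^+ 2 + B ^+ 2) * (P ^+ 2 + Q ^+ 2) - (D * G * P + B * Q) ^+ 2 =
  (D * G * Q - B * P) ^+ 2 by ring.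
exact: sqr_ge0.
Qed.

End Fidelity.

(** * Overlaps of phase-shifted and product states, and the gap they allow in a measurement *)

Section Protocol.
Context {R : realType}.
Local Notation C := (complex R).

Lemma embX_dot k (u v : 'cV[C]_(2 ^ k)) : (embX u)^t* *m embX v = u^t* *m v.
Proof. by rewrite /embX tr_col_mx map_row_mx mul_row_col mulmx0 add0r. Qed.

Lemma embX_bot k (u : 'cV[C]_(2 ^ k)) : (embX u)^t* *m bot k = 0.
Proof.
by rewrite /embX /bot tr_col_mx map_row_mx mul_row_col mulmx0 addr0 trmx0 map_mx0 mul0mx.
Qed.

Lemma bot_dot k : (bot k)^t* *m bot k = 1%:M :> 'M[C]_1.
Proof.
by rewrite /bot tr_col_mx map_row_mx mul_row_col mulmx0 addr0 trmx1 map_mx1 mulmx1.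
Qed.

(** Indices pair up as [2 m] and [2 m + 1], the two values of the last qubit. *)
Lemma sum_parity (V : zmodType) k (x y : V) :
  \sum_(i < 2 ^ k.+1) (if odd i then x else y) = (x + y) *+ 2 ^ k.
Proof.
rewrite -(big_mkord xpredT (fun i => if odd i then x else y)) expnS mul2n.
elim: (2 ^ k)%N => [|m IH]; first by rewrite big_nil.
rewrite doubleS !big_nat_recr //= IH odd_double /= mulrSr.
by rewrite -[LHS]addrA; congr (_ + _); rewrite addrC.
Qed.

Lemma expi_norm (a : R) : Num.conj (expi a) * expi a = 1 :> C.
Proof.
by rewrite -normCKC -add_Re2_Im2 /= cos2Dsin2.
Qed.

Lemma plusk_alpha_dot k (a b : R) :
  (plusk_alpha k.+1 a)^t* *m plusk_alpha k.+1 b =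
  ((1 + Num.conj (expi a) * expi b) / 2)%:M.
Proof.
apply/matrixP => i j; rewrite !ord1 !mxE mulr1n.
under eq_bigr => l _.
  rewrite !mxE rmorphM /= (_ : Num.conj _ = (Num.sqrt (2 ^+ k.+1 : R))^-1%:C); last first.
    by apply/CrealP/complex_realP; eexists.
  rewrite mulrACA -rmorphM /= -expr2 exprVn sqr_sqrtr ?exprn_ge0 //.
  rewrite (_ : Num.conj _ * _ = if odd l then Num.conj (expi a) * expi b else 1); last first.
    by case: ifP => // _; rewrite rmorph1 mulr1.
  over.
rewrite -mulr_sumr sum_parity -[_ *+ 2 ^ k]mulr_natl mulrA addrC mulrC; congr (_ * _).
rewrite natrX fmorphV rmorphXn /= exprSr invfM.
have -> : (2 : R)%:C = 2 :> C by rewrite rmorph_nat.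
by rewrite mulrAC mulVf ?mul1r// expf_neq0 // pnatr_eq0.
Qed.

Lemma plusk_alpha0 k : plusk k = plusk_alpha k (0 : R).
Proof.
by apply/matrixP => i j; rewrite !mxE /expi cos0 sin0; case: ifP; rewrite mulr1.
Qed.

Lemma plusk_alpha_unit k (a : R) :
  (plusk_alpha k.+1 a)^t* *m plusk_alpha k.+1 a = 1%:M.
Proof. by rewrite plusk_alpha_dot expi_norm (_ : 1 + 1 = 2) // divff ?pnatr_eq0. Qed.

(** The squared overlap is [cos^2 (a / 2)]; here and below [(1 - cos a) / 2] stands for
    [sin^2 (a / 2)]. *)
Lemma plusk_overlap (a : R) :
  `|(1 + Num.conj (expi a) * expi 0) / 2 : C| ^+ 2 = (1 - (1 - cos a) / 2)%:C.
Proof.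
have h : (1 + Num.conj (expi a) * expi 0) / 2 = ((1 + cos a) / 2) +i* (- sin a / 2) :> C.
  have -> : expi 0 = 1 :> C by rewrite /expi cos0 sin0.
  have -> : (2 : C)^-1 = (2^-1 : R)%:C by rewrite fmorphV rmorph_nat.
  have -> : Num.conj (expi a) = cos a -i* sin a by [].
  by apply/eqP; rewrite mulr1 eq_complex /= !mulr0 subr0 !add0r !eqxx.
rewrite h -add_Re2_Im2 /=; congr (_ %:C).
rewrite !exprMn sqrrN sin2cos2.
by field.
Qed.

(** Distributivity of the product over the sums, with a choice of one [x] per factor encoded as the
    base [2 ^ k] digits of [i]. *)
Lemma sum_digits k n (F : 'I_n -> 'I_(2 ^ k) -> C) :
  \sum_(i < (2 ^ k) ^ n) \prod_(j < n) F j (digit k j i) = \prod_(j < n) \sum_x F j x.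
Proof.
elim: n F => [|n IH] F.
  by rewrite expn0 big_ord1 !big_ord0.
rewrite big_ord_recl -IH mulrC.
set D := (2 ^ k)%N in F *; have D0 : (0 < D)%N by rewrite expn_gt0.
rewrite -(big_mkord xpredT (fun i => \prod_(j < n.+1) F j (digit k j i))).
(* Writing [i = q D + x], the lowest digit is [x] and digit [j + 1] of [i] is digit [j] of [q]. *)
rewrite expnSr big_nat_mul big_mkord mulr_suml; apply: eq_bigr => q _.
rewrite mulSn -{1}[(q * D)%N]add0n big_addn addnK big_mkord mulr_sumr.
apply: eq_bigr => x _; rewrite big_ord_recl [RHS]mulrC; congr (_ * _).
  by congr (F _ _); apply: val_inj; rewrite /= expn0 divn1 addnC modnMDl modn_small.
apply: eq_bigr => j _; congr (F _ _); apply: val_inj => /=.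
by rewrite /bump leq0n add1n expnS divnMA addnC divnMDl // (divn_small (ltn_ord x)) addn0.
Qed.

Lemma tensvec_dot k n (v w : 'I_n -> 'cV[C]_(2 ^ k)) :
  (tensvec v)^t* *m tensvec w = (\prod_(j < n) ((v j)^t* *m w j) 0 0)%:M.
Proof.
apply/matrixP => i j; rewrite !ord1 !mxE mulr1n.
transitivity (\sum_(i < (2 ^ k) ^ n) \prod_(j < n)
   (fun j x => Num.conj (v j x 0) * w j x 0) j (digit k j i)).
  by apply: eq_bigr => l _; rewrite !mxE rmorph_prod -big_split.
rewrite (sum_digits (fun j x => Num.conj (v j x 0) * w j x 0)).
apply: eq_bigr => l _; rewrite !mxE.
by apply: eq_bigr => x _; rewrite !mxE.
Qed.

Lemma tensvec_unit k n (v : 'I_n -> 'cV[C]_(2 ^ k)) :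
  (forall j, (v j)^t* *m v j = 1%:M) -> (tensvec v)^t* *m tensvec v = 1%:M.
Proof.
by move=> v1; rewrite tensvec_dot big1 // => j _; rewrite v1 mxE.
Qed.

(** With [Q] the weight of [psi] on odd indices, the overlap is the convex combination
    [expi a * Q + (1 - Q)]. Its modulus is least at the midpoint [Q = 1 / 2], where its square is
    [cos^2 (a / 2)]. *)
Lemma phase_overlap k (a : R) (psi : 'cV[C]_(2 ^ k)) : psi^t* *m psi = 1%:M ->
  (1 - (1 - cos a) / 2)%:C <= `|(psi^t* *m (Aphase k a *m psi)) 0 0| ^+ 2.
Proof.
move=> psi1.
pose P : C := \sum_(i < 2 ^ k | ~~ odd i) `|psi i 0| ^+ 2.
pose Q : C := \sum_(i < 2 ^ k | odd i) `|psi i 0| ^+ 2.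
have PQ : Q + P = 1.
  have := congr1 (fun M : 'M[C]_1 => M 0 0) psi1.
  rewrite !mxE mulr1n => <-; rewrite (bigID (fun i : 'I_(2 ^ k) => odd i)) /=.
  by congr (_ + _); apply: eq_bigr => i _; rewrite !mxE normCKC.
have -> : (psi^t* *m (Aphase k a *m psi)) 0 0 = expi a * Q + P.
  rewrite mxE (bigID (fun i : 'I_(2 ^ k) => odd i)) /= mulr_sumr.
  congr (_ + _); apply: eq_bigr => i oi;
    rewrite /Aphase mul_diag_mx !mxE ?oi ?(negbTE oi) normCKC ?mul1r //.
  by rewrite mulrCA.
have /complex_realP[q qE] : Q \is Num.real.
  by apply: ger0_real; apply: sumr_ge0 => i _; rewrite exprn_ge0.
have -> : P = (1 - q)%:C by rewrite -[P](addKr Q) PQ qE rmorphB /= addrC.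
have -> : expi a * Q + (1 - q)%:C = (cos a * q + (1 - q)) +i* (sin a * q).
  by apply/eqP; rewrite qE eq_complex /= !mulr0 subr0 add0r addr0 !eqxx.
rewrite -add_Re2_Im2 lecR /= [(sin a * q) ^+ 2]exprMn sin2cos2 -subr_ge0.
have -> : (cos a * q + (1 - q)) ^+ 2 + (1 - cos a ^+ 2) * q ^+ 2 - (1 - (1 - cos a) / 2)
  = (1 - cos a) * ((2 * q - 1) ^+ 2 / 2) by field.
by rewrite mulr_ge0 ?subr_ge0 ?cos_le1 // divr_ge0 // sqr_ge0.
Qed.

(** Here [f] and [h] are acceptance probabilities of two states, [x] and [y] the moduli of the
    accept and reject parts of their overlap, and [c] the modulus of the overlap. *)
Lemma prob_gap_real (f h c x y g : R) :
  0 <= f -> 0 <= h -> 0 <= 1 - f -> 0 <= 1 - h -> 0 <= c -> 0 <= y -> 0 <= x ->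
  c <= x + y -> y ^+ 2 <= (1 - f) * (1 - h) -> x ^+ 2 <= f * h -> g <= c ^+ 2 ->
  (f - h) ^+ 2 <= 1 - g.
Proof.
move=> f0 h0 f1 h1 c0 y0 x0 cxy hy hx gc.
(* By hypothesis [x y] is at most the geometric mean of [f (1 - f)] and [h (1 - h)], hence at most
   their arithmetic mean. *)
have xy : x * y <= (f * (1 - f) + h * (1 - h)) / 2.
  rewrite -(ler_pXn2r (ltn0Sn 1)) ?nnegrE; last 2 first.
  - by rewrite mulr_ge0.
  - by rewrite divr_ge0 // addr_ge0 // mulr_ge0.
  rewrite exprMn; apply: (@le_trans _ _ ((f * h) * ((1 - f) * (1 - h)))).
    by rewrite ler_pM // sqr_ge0.
  rewrite -subr_ge0.
  have -> : ((f * (1 - f) + h * (1 - h)) / 2) ^+ 2 - f * h * ((1 - f) * (1 - h)) =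
    ((f * (1 - f) - h * (1 - h)) / 2) ^+ 2 by field.
  exact: sqr_ge0.
have c2 : c ^+ 2 <= (x + y) ^+ 2 by rewrite ler_pXn2r // nnegrE // addr_ge0.
(* The right-hand side equals [1 - (f - h)^2]. *)
have : (x + y) ^+ 2 <= f * h + (1 - f) * (1 - h) + (f * (1 - f) + h * (1 - h)).
  by rewrite sqrrD -mulr_natr; lra.
move=> xy2; have := le_trans gc (le_trans c2 xy2); lra.
Qed.

Lemma ger0_complex (z : C) : 0 <= z -> exists2 x : R, z = x%:C & 0 <= x.
Proof.
move=> z0; have /complex_realP[x zx] := ger0_real z0.
by exists x => //; rewrite -ler0c -zx.
Qed.

(** The inner product of [u] and [v] splits into the forms of [mu] and [1 - mu]; Cauchy-Schwarz
    bounds each part by the outcome probabilities. *)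
Lemma psd_prob_gap n (mu : 'M[C]_n) (u v : 'cV[C]_n) (g : R) :
  psd mu -> psd (1%:M - mu) -> u^t* *m u = 1%:M -> v^t* *m v = 1%:M ->
  g%:C <= `|(u^t* *m v) 0 0| ^+ 2 ->
  (complex.Re (sform mu u u) - complex.Re (sform mu v v)) ^+ 2 <= 1 - g.
Proof.
move=> pmu pmu' u1 v1.
have split w z : sform (1%:M - mu) w z = (w^t* *m z) 0 0 - sform mu w z.
  by apply/eqP; rewrite eq_sym subr_eq -sform1 -sform_addmx subrK.
have CS := semipos_Cauchy_Schwarz u v pmu; have CS' := semipos_Cauchy_Schwarz u v pmu'.
have := ler_normD (sform mu u v) (sform (1%:M - mu) u v).
rewrite -sform_addmx (addrC mu) subrK sform1 => tri gc.
have [f fE f0] := ger0_complex (pmu u : 0 <= sform mu u u).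
have [h hE h0] := ger0_complex (pmu v : 0 <= sform mu v v).
have fE' : sform (1%:M - mu) u u = (1 - f)%:C by rewrite split u1 fE mxE rmorphB.
have hE' : sform (1%:M - mu) v v = (1 - h)%:C by rewrite split v1 hE mxE rmorphB.
have f1 : 0 <= 1 - f by rewrite -ler0c -fE'; apply: pmu'.
have h1 : 0 <= 1 - h by rewrite -ler0c -hE'; apply: pmu'.
have [x xE x0] := ger0_complex (normr_ge0 (sform mu u v)).
have [y yE y0] := ger0_complex (normr_ge0 (sform (1%:M - mu) u v)).
have [c cE c0] := ger0_complex (normr_ge0 ((u^t* *m v) 0 0)).
rewrite fE hE.
move: CS CS' tri gc; rewrite fE hE fE' hE' xE yE cE -rmorphD -!rmorphM -!rmorphXn !lecR.
move=> hx hy cxy gc; exact: (prob_gap_real f0 h0 f1 h1 c0 y0 x0 cxy hy hx gc).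
Qed.

End Protocol.

(** * Effect of the phase attack on the acceptance probability for fixed [n] and [l] *)

Section Acceptance.
Context {R : realType}.
Local Notation C := (complex R).

Lemma bernoulli_ineq (s : R) n : 0 <= s <= 1 -> 1 - n%:R * s <= (1 - s) ^+ n.
Proof.
move=> /andP[s0 s1]; elim: n => [|n IH]; first by rewrite mul0r subr0 expr0.
rewrite exprS; have n0 : (0 : R) <= n%:R by [].
have : (1 - s) * (1 - n%:R * s) <= (1 - s) * (1 - s) ^+ n.
  by apply: ler_wpM2l => //; rewrite subr_ge0.
apply: le_trans; rewrite -natr1 -subr_ge0.
have -> : (1 - s) * (1 - n%:R * s) - (1 - (n%:R + 1) * s) = n%:R * (s * s) by ring.
by rewrite !mulr_ge0.
Qed.

Lemma half_1Bcos_itv (a : R) : 0 <= (1 - cos a) / 2 <= 1.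
Proof. by have := cos_le1 a; have := cos_geN1 a => ? ?; apply/andP; split; lra. Qed.

Lemma unitary_unit n (T : 'M[C]_n) (v : 'cV[C]_n) :
  T \is unitarymx -> v^t* *m v = 1%:M -> (T *m v)^t* *m (T *m v) = 1%:M.
Proof.
by move=> uT v1; rewrite adjmxM mulmxA mulmxKtV // v1.
Qed.

Lemma Aphase_unitary k (a : R) : Aphase k a \is unitarymx.
Proof.
apply/unitarymxP; rewrite /Aphase tr_diag_mx map_diag_mx mulmx_diag.
apply/matrixP => i j; rewrite !mxE; case: eqP => // _; congr (_ *+ _).
by case: ifP => _; rewrite ?rmorph1 ?mulr1 // mulrC expi_norm.
Qed.

Lemma attack_unit k before (a : R) (T : 'M[C]_(2 ^ k)) (v : 'cV[C]_(2 ^ k)) :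
  T \is unitarymx -> v^t* *m v = 1%:M ->
  (attack before a T *m v)^t* *m (attack before a T *m v) = 1%:M.
Proof.
move=> uT v1; rewrite /attack; case: before; rewrite -mulmxA;
  by do 2! [apply: unitary_unit => //; try exact: Aphase_unitary].
Qed.

(** For an attack before [T], unitarity cancels [T] and leaves the overlap at [v]; for one after
    [T], it is the overlap at the unit vector [T *m v]. *)
Lemma attack_overlap k before (a : R) (T : 'M[C]_(2 ^ k)) (v : 'cV[C]_(2 ^ k)) :
  T \is unitarymx -> v^t* *m v = 1%:M ->
  (1 - (1 - cos a) / 2)%:C <= `|((T *m v)^t* *m (attack before a T *m v)) 0 0| ^+ 2.
Proof.
move=> uT v1; rewrite /attack; case: before; rewrite -mulmxA.
  rewrite adjmxM [_ *m (T *m _)]mulmxA mulmxKtV //; exact: phase_overlap.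
by apply: phase_overlap; apply: unitary_unit.
Qed.

Lemma paccE k n (U : 'I_n.+1 -> 'M[C]_(2 ^ k)) chi (mu : 'M[C]_((2 ^ k) ^ n)) l :
  pacc U chi mu l = let t := tensvec (fun j : 'I_n => U (lift l j) *m chi (lift l j)) in
  complex.Re (sform mu t t).
Proof.
by rewrite /pacc /sform /proj mulmxA mxtrace_mulC mulmxA trace_mx11.
Qed.

Lemma pacc_itv k n (U : 'I_n.+1 -> 'M[C]_(2 ^ k)) chi (mu : 'M[C]_((2 ^ k) ^ n)) l :
  psd mu -> psd (1%:M - mu) ->
  (forall i, (U i *m chi i)^t* *m (U i *m chi i) = 1%:M) ->
  0 <= pacc U chi mu l <= 1.
Proof.
move=> pmu pmu' U1; rewrite paccE /=; set t := tensvec _.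
have t1 : t^t* *m t = 1%:M by apply: tensvec_unit => j.
have [f fE f0] := ger0_complex (pmu t : 0 <= sform mu t t).
have e1 : sform (1%:M - mu) t t = (1 - f)%:C.
  apply/eqP; rewrite rmorphB /= -fE eq_sym subr_eq -sform_addmx subrK sform1 t1 mxE.
  by rewrite mulr1n.
have f1 : 0 <= 1 - f by rewrite -ler0c -e1; apply: pmu'.
by rewrite fE f0 /= -subr_ge0.
Qed.

Lemma pacc_attack_gap k n (T : 'I_n.+1 -> 'M[C]_(2 ^ k)) chi (mu : 'M[C]_((2 ^ k) ^ n))
    before (a : R) l :
  psd mu -> psd (1%:M - mu) -> (forall i, T i \is unitarymx) ->
  (forall i, (chi i)^t* *m chi i = 1%:M) ->
  (pacc T chi mu l - pacc (fun i => attack before a (T i)) chi mu l) ^+ 2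
  <= n%:R * ((1 - cos a) / 2).
Proof.
move=> pmu pmu' uT chi1; rewrite !paccE /=.
set s := (1 - cos a) / 2.
(* Takes [g = 1 - n s], which may be negative; the product of the overlaps dominates [(1 - s)^n],
   and Bernoulli gives [g <= (1 - s)^n]. *)
rewrite -[leRHS](subKr 1); apply: psd_prob_gap => //.
- by apply: tensvec_unit => j; apply: unitary_unit.
- by apply: tensvec_unit => j; apply: attack_unit.
rewrite tensvec_dot mxE mulr1n normr_prod -prodrXl.
apply: (@le_trans _ _ ((1 - s) ^+ n)%:C).
  by rewrite lecR bernoulli_ineq // half_1Bcos_itv.
rewrite rmorphXn /= -[X in _ ^+ X](card_ord n) -prodr_const.
apply: ler_prod => j _; rewrite attack_overlap // andbT ler0c subr_ge0.
by have /andP[] := half_1Bcos_itv a.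
Qed.

End Acceptance.

Local Open Scope classical_set_scope.

(** * Averaging over the number of test rounds and the output round *)

Section Averages.
Context {R : realType}.
Context (Omega : nat -> R) (Omega_ge0 : forall n, 0 <= Omega n).
Context (Omega_sum : series Omega @ \oo --> (1 : R)).

Definition round_mean (p : forall n, 'I_n.+1 -> R) n : R :=
  Omega n / n.+1%:R * \sum_(l < n.+1) p n l.

Lemma round_mean_le (p : forall n, 'I_n.+1 -> R) n c :
  (forall l, p n l <= c) -> round_mean p n <= Omega n * c.
Proof.
move=> pc; apply: (@le_trans _ _ (Omega n / n.+1%:R * \sum_(l < n.+1) c)).
  by apply: ler_wpM2l; [rewrite divr_ge0 | apply: ler_sum].
by rewrite sumr_const card_ord -[c *+ _]mulr_natl mulrA divfK // pnatr_eq0.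
Qed.

Lemma round_mean_ge0 (p : forall n, 'I_n.+1 -> R) n :
  (forall l, 0 <= p n l) -> 0 <= round_mean p n.
Proof. by move=> p0; rewrite mulr_ge0 ?divr_ge0 // sumr_ge0. Qed.

Lemma round_meanB (p q : forall n, 'I_n.+1 -> R) n :
  round_mean (fun n l => p n l - q n l) n = round_mean p n - round_mean q n.
Proof. by rewrite /round_mean sumrB mulrBr. Qed.

(** Domination by [Omega]; convergence is what gives the [limn] in [pavg] its meaning as a sum. *)
Lemma round_mean_cvg (p : forall n, 'I_n.+1 -> R) :
  (forall n l, 0 <= p n l <= 1) -> cvgn (series (round_mean p)).
Proof.
move=> p01; apply: (@series_le_cvg _ _ Omega) => //.
- by move=> n; apply: round_mean_ge0 => l; case/andP: (p01 n l).
- move=> n; rewrite -[leRHS]mulr1; apply: round_mean_le => l.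
  by case/andP: (p01 n l).
- by apply/cvg_ex; exists 1.
Qed.

Lemma pavg_itv (p : forall n, 'I_n.+1 -> R) :
  (forall n l, 0 <= p n l <= 1) -> 0 <= pavg Omega p <= 1.
Proof.
move=> p01; have cp := round_mean_cvg p01.
have cO : cvgn (series Omega) by apply/cvg_ex; exists 1.
apply/andP; split.
  apply: limr_ge => //; apply: nearW => m; apply: sumr_ge0 => n _.
  by apply: round_mean_ge0 => l; case/andP: (p01 n l).
rewrite -[leRHS](cvg_lim (@Rhausdorff R) Omega_sum); apply: lim_series_le => // n.
by rewrite -[leRHS]mulr1; apply: round_mean_le => l; case/andP: (p01 n l).
Qed.

(** A bound affine in [n] averages exactly through the mean [N], so a linearised square root can
    replace Jensen's inequality. *)
Lemma pavg_gap (p q : forall n, 'I_n.+1 -> R) (N a b : R) :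
  series (fun n => n%:R * Omega n) @ \oo --> N ->
  (forall n l, 0 <= p n l <= 1) -> (forall n l, 0 <= q n l <= 1) ->
  (forall n l, p n l - q n l <= a * n%:R + b) ->
  pavg Omega p - pavg Omega q <= a * N + b.
Proof.
move=> cN p01 q01 pq.
have cp := round_mean_cvg p01; have cq := round_mean_cvg q01.
pose g : R^nat := fun n => a * (n%:R * Omega n) + b * Omega n.
have cg : series g @ \oo --> a * N + b.
  rewrite (_ : series g =
    fun m => a * series (fun n => n%:R * Omega n) m + b * series Omega m); last first.
    by apply/funext => m; rewrite /series /= big_split !mulr_sumr.
  rewrite -[X in _ --> _ + X]mulr1.
  by apply: cvgD; apply: cvgM => //; exact: cvg_cst.
rewrite -(cvg_lim (@Rhausdorff R) cg).
rewrite -[X in X <= _]lim_seriesB //; apply: lim_series_le => //.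
- exact: is_cvg_seriesB.
- by apply/cvg_ex; exists (a * N + b).
move=> n; rewrite -[leLHS]/(round_mean p n - round_mean q n) -round_meanB.
apply: le_trans (round_mean_le (pq n)) _.
by rewrite /g; lra.
Qed.

End Averages.

(** * Fidelities of the output states and the final numerical trade-off *)

Section OutputFidelity.
Context {R : realType}.

Lemma fidelity_rhoH k (p : R) : 0 <= p <= 1 ->
  fidelity (rhoH k.+1 p) (proj (embX (plusk k.+1))) = p%:C.
Proof.
move=> /andP[p0 p1]; rewrite /rhoH plusk_alpha0.
set u := embX _; set b := bot _.
have u1 : u^t* *m u = 1%:M by rewrite embX_dot plusk_alpha_unit.
have ub : u^t* *m b = 0 by exact: embX_bot.
have e1 : `|1 : complex R| ^+ 2 = (1 : R)%:C by rewrite normr1 expr1n.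
have q0 : 0 <= 1 - p by rewrite subr_ge0.
(* The pure target is the mixture with weights 1 and 0, and its overlap with itself is 1. *)
have := fidelity_proj2 p0 q0 ler01 (lexx 0) ler01 u1 (bot_dot k.+1) ub ub u1 e1.
by rewrite rmorph0 rmorph1 scale0r scale1r addr0 !mulr1 mulr0 sqrtr0 addr0 sqr_sqrtr.
Qed.

(** The bound is uniform in [p], so it applies to whichever ideal mixture the security hypothesis
    supplies. *)
Lemma fidelity_rhoD_le k (d p a : R) : 0 <= d <= 1 -> 0 <= p <= 1 ->
  fidelity (rhoD k.+1 d a)
    (p%:C *: proj (embX (plusk k.+1)) + (1 - p)%:C *: proj (bot k.+1))
  <= (1 - d * ((1 - cos a) / 2))%:C.
Proof.
move=> d01 p01; rewrite /rhoD plusk_alpha0.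
set u := embX (plusk_alpha _ a); set v := embX (plusk_alpha _ 0); set b := bot _.
have u1 : u^t* *m u = 1%:M by rewrite embX_dot plusk_alpha_unit.
have ub : u^t* *m b = 0 by exact: embX_bot.
have vb : v^t* *m b = 0 by exact: embX_bot.
have uv : u^t* *m v = ((1 + Num.conj (expi a) * expi 0) / 2)%:M.
  by rewrite embX_dot plusk_alpha_dot.
have g0 : 0 <= 1 - (1 - cos a) / 2.
  by rewrite subr_ge0; have /andP[] := half_1Bcos_itv a.
have := fidelity_proj2_le d01 p01 g0 u1 (bot_dot k.+1) ub vb uv (plusk_overlap a).
by rewrite subKr.
Qed.

(* [2 / 3] is the value of [sqrt (N s)] for the final choice of [s]. *)
Lemma AMGM_two_thirds (x y : R) : x ^+ 2 <= y -> x <= 3 / 4 * y + 1 / 3.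
Proof. by have := sqr_ge0 (x - 2 / 3); rewrite sqrrB -mulr_natr; lra. Qed.

(** The first hypotheses give [d >= 1 / 3 - eH]; multiplying by [s] yields [eD >= s / 3 - eH s], and
    [eH s <= eH]. *)
Lemma eps_tradeoff (s h d eH eD : R) : 0 <= s <= 1 -> 0 <= eH ->
  1 - eH <= h -> h - d <= 2 / 3 -> d * s <= eD -> s / 3 <= eH + eD.
Proof.
move=> /andP[s0 s1] eH0 hh hd ds.
have : (1 / 3 - eH) * s <= d * s by apply: ler_wpM2r => //; lra.
have : eH * s <= eH by rewrite ler_piMr.
lra.
Qed.

End OutputFidelity.

Theorem theorem1 (R : realType) (k : nat) (hk : (1 <= k)%N)
  (Omega : nat -> R)
  (hOmega_ge0 : forall n, 0 <= Omega n)
  (hOmega_sum : series Omega @ \oo --> (1 : R))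
  (N : R)
  (hN_mean : series (fun n => n%:R * Omega n) @ \oo --> N)
  (hN : 1 <= N)
  (T : forall n : nat, 'I_n.+1 -> 'M[complex R]_(2 ^ k))
  (hT : forall n (i : 'I_n.+1), T n i \is unitarymx)
  (chi : forall n : nat, 'I_n.+1 -> 'cV[complex R]_(2 ^ k))
  (hchi : forall n (i : 'I_n.+1), (chi n i)^t* *m chi n i = 1%:M)
  (mu : forall n : nat, 'M[complex R]_((2 ^ k) ^ n))
  (hmu0 : forall n, psd (mu n))
  (hmu1 : forall n, psd (1%:M - mu n))
  (before : bool)
  (epsH epsD : R) (hepsH : 0 <= epsH) (hepsD : 0 <= epsD)
  (hcorrect : ((1 - epsH)%:C <=
      fidelity (rhoH k (pH Omega T chi mu)) (proj (embX (plusk k)))))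
  (hsecure : forall a : R, exists2 p : R, 0 <= p <= 1 &
      ((1 - epsD)%:C <=
        fidelity (rhoD k (pD Omega T chi mu before a) a)
          (p%:C *: proj (embX (plusk k)) + (1 - p)%:C *: proj (bot k)))) :
  1 / (7 * N) <= epsH + epsD.
Proof.
(* Making [k] a successor provides the last qubit that carries the phase. *)
case: k hk T hT chi hchi mu hmu0 hmu1 hcorrect hsecure => // k _ T uT chi chi1 mu mu0 mu1.
set h := pH Omega T chi mu => hcorrect hsecure.
pose s : R := 4 / (9 * N).
have N0 : 0 < N by apply: lt_le_trans hN.
have s0 : 0 < s by rewrite divr_gt0 // mulr_gt0.
have sN : s * N = 4 / 9 by rewrite /s; field; rewrite gt_eqF.
have s1 : s <= 4 / 9 by rewrite -sN ler_peMr // ltW.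
(* The bound [s <= 4 / 9], due to [N >= 1], puts [1 - 2 s] in the domain of [acos], so that
   [sin^2 (a / 2) = s]. *)
pose a := acos (1 - 2 * s).
have cosa : (1 - cos a) / 2 = s.
  by rewrite /a acosK; [field | rewrite in_itv /=; apply/andP; split; lra].
have Tchi n i : (T n i *m chi n i)^t* *m (T n i *m chi n i) = 1%:M.
  exact: unitary_unit.
have pH01 n l : 0 <= pacc (T n) (chi n) (mu n) l <= 1 by exact: pacc_itv.
have pD01 n l : 0 <= pacc (fun i => attack before a (T n i)) (chi n) (mu n) l <= 1.
  by apply: pacc_itv => // i; apply: attack_unit.
have h01 : 0 <= h <= 1 by exact: pavg_itv.
have {}hcorrect : 1 - epsH <= h by rewrite fidelity_rhoH // lecR in hcorrect.
set d := pD Omega T chi mu before a.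
have d01 : 0 <= d <= 1 by exact: pavg_itv.
have gap : h - d <= 2 / 3.
  (* For each [n], [sqrt (n s)] lies below its tangent [3 / 4 * (n s) + 1 / 3] taken at
     [n s = 4 / 9]; averaging turns [n] into [N], where the tangent meets the root. *)
  have -> : 2 / 3 = 3 / 4 * s * N + 1 / 3 by rewrite -mulrA sN; field.
  apply: pavg_gap => // n l.
  have := pacc_attack_gap before a l (mu0 n) (mu1 n) (uT n) (chi1 n).
  by rewrite cosa [n%:R * s]mulrC => /AMGM_two_thirds; rewrite mulrA.
have secure : d * s <= epsD.
  have [p p01 hp] := hsecure a.
  have := le_trans hp (fidelity_rhoD_le k a d01 p01).
  by rewrite cosa lecR; lra.
have s01 : 0 <= s <= 1 by rewrite ltW // (le_trans s1) //; lra.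
apply: le_trans (eps_tradeoff s01 hepsH hcorrect gap secure).
rewrite /s ler_pdivrMr ?mulr_gt0 //.
(* The bound obtained, [s / 3 = 4 / (27 N)], exceeds [1 / (7 N)] by the factor [28 / 27]. *)
have -> : 4 / (9 * N) / 3 * (7 * N) = 28 / 27 by field; rewrite gt_eqF.
lra.
Qed.
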